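(* Suppose that $X\subset\mathbb{R}^N$ and the system $x_{t+1}=f(x_t,w_t)$, where $(w_t)_{t\in\mathbb{Z}_+}$ is an i.i.d. noise process, is such that for some $K\in\mathbb{R}_+$, all Borel sets $B\subset\mathbb{R}^N$ and all $x\in X$, $$P(x_{t+1}\in B\,|\,x_t=x)\le K\lambda(B),$$ where $\lambda$ denotes Lebesgue measure. Consider estimation of the state over a discrete channel of Class A type with the objective (E2), for given $\varepsilon>0$: $$P\Bigl(\limsup_{t\to\infty}\|x_t-\hat x_t\|\le\varepsilon\Bigr)=1.$$ Then $C_0=\infty$, where $C_0$ is the smallest channel capacity above which (E2) can be achieved for every $\varepsilon>0$.
   Context: All logarithms and entropies are to base 2; $\mathbb{Z}_+=\{0,1,2,\dots\}$; $z_{[0,t]}=(z_0,\dots,z_t)$; $\|\cdot\|$ is the Euclidean norm on $\mathbb{R}^N$. System: $X$ carries the Euclidean metric, $W$ is a measurable space, $f:X\times W\to X$ is Borel measurable and $f(\cdot,w)$ is a homeomorphism of $X$ for every $w\in W$; $(w_t)$ takes values in $W$ and is independent of the random initial state $x_0\sim\pi_0$. Coding and estimation: the channel is discrete with finite input alphabet $\mathcal{M}=\{1,\dots,M\}$ and finite output alphabet $\mathcal{M}'$, mapping $q_t$ to $q'_t$ according to conditional probabilities $P(q'_t|q_t,q_{[0,t-1]},q'_{[0,t-1]})$. A coding policy is a sequence of (measurable) maps with $q_t=\gamma^e_t(x_{[0,t]},q'_{[0,t-1]})\in\mathcal{M}$ (so the encoder has channel feedback); an estimation policy is a sequence of maps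 with $\hat x_t=\gamma^d_t(q'_{[0,t]})\in X$. Class A type channel: (1) almost surely, for all Borel sets $B$ and all $t\ge0$, $$P(q'_t\in B\,|\,q_t,q_{[0,t-1]},q'_{[0,t-1]},x_0,w_s,s\ge0)=P(q'_t\in B\,|\,q_t,q_{[0,t-1]},q'_{[0,t-1]});$$ (2) its capacity with feedback is given by $$C=\lim_{T\to\infty}\ \max_{\{P(q_t|q_{[0,t-1]},q'_{[0,t-1]}),\,0\le t\le T-1\}}\ \frac1T I(q_{[0,T-1]}\to q'_{[0,T-1]}),$$ where the directed mutual information is $I(q_{[0,T-1]}\to q'_{[0,T-1]})=\sum_{t=1}^{T-1}I(q_{[0,t]};q'_t|q'_{[0,t-1]})+I(q_0;q'_0)$. $C_0$ is the infimum of the capacities of such channels over which, for every $\varepsilon>0$, there exist coding and estimation policies achieving (E2) with that $\varepsilon$ (infimum of the empty set is $\infty$). Thus $C_0=\infty$ means that for no such channel can (E2) be achieved for all $\varepsilon>0$. *)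

(* Defs.v *)
From HB Require Import structures.
From mathcomp Require Import all_boot all_order all_algebra.
From mathcomp Require Import all_classical all_reals all_analysis.

Set Implicit Arguments.
Unset Strict Implicit.
Unset Printing Implicit Defensive.
Import Order.TTheory GRing.Theory Num.Theory.
Import numFieldNormedType.Exports.

Local Open Scope classical_set_scope.
Local Open Scope ring_scope.

(* [borelSpace t0] is the topological space T with its Borel sigma-algebra.
   MathComp-Analysis only has pointed measurable spaces, whence the point t0,
   which plays no other role. *)
Definition borelSpace (T : topologicalType) (t0 : T) : Type := T.

Section BorelSpace.
Context (T : topologicalType) (t0 : T).
Let borel : set (set T) := <<s [set U : set T | open U] >>.
Let borel0 : borel set0. Proof. exact: sigma_algebra0. Qed.
Let borelC A : borel A -> borel (~` A).
Proof. by move=> bA; rewrite -setTD; exact: sigma_algebraCD. Qed.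
Let borel_bigcup (F : (set T)^nat) :
  (forall i, borel (F i)) -> borel (\bigcup_i (F i)).
Proof. exact: sigma_algebra_bigcup. Qed.

HB.instance Definition _ := Topological.copy (borelSpace t0) T.
HB.instance Definition _ := isPointed.Build (borelSpace t0) t0.
HB.instance Definition _ :=
  @isMeasurable.Build default_measure_display (borelSpace t0)
    borel borel0 borelC borel_bigcup.
End BorelSpace.

Section EuclideanSpace.
Context {R : realType} {N : nat}.

Definition enorm (v : 'rV[R]_N) : R := Num.sqrt (\sum_(i < N) v ord0 i ^+ 2).

Definition borel_set (B : set 'rV[R]_N) : Prop :=
  <<s [set U : set 'rV[R]_N | open U] >> B.

Definition box (a b : 'rV[R]_N) : set 'rV[R]_N :=
  [set v | forall i, a ord0 i < v ord0 i <= b ord0 i].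

(* Lebesgue measure: infimum of the total volume of the countable covers by
   boxes. This is the outer measure; it is only applied to Borel sets. *)
Definition lebesgue_rV (B : set 'rV[R]_N) : \bar R :=
  ereal_inf [set (\sum_(0 <= k <oo)
                    (\prod_(i < N) (ab.2 k ord0 i - ab.1 k ord0 i))%:E)%E
            | ab in [set ab : (nat -> 'rV[R]_N) * (nat -> 'rV[R]_N) |
                      (forall k i, ab.1 k ord0 i <= ab.2 k ord0 i) /\
                      B `<=` \bigcup_k box (ab.1 k) (ab.2 k)]].

End EuclideanSpace.

Definition homeomorphism (T : topologicalType) (h : T -> T) : Prop :=
  continuous h /\
  exists g : T -> T, [/\ continuous g, cancel h g & cancel g h].

(* phi is a version of P(E | H), H being a sub-sigma-algebra. *)
Definition is_cond_prob {R : realType} {d} {Omega : measurableType d}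
    (P : probability Omega R) (H : set (set Omega)) (E : set Omega)
    (phi : Omega -> R) : Prop :=
  (forall Y : set R, measurable Y -> H (phi @^-1` Y)) /\
  (forall A : set Omega, H A ->
     (\int[P]_(omega in A) (phi omega)%:E)%E = P (A `&` E)).

(* z_{[0,n-1]} *)
Definition hist {A : Type} (z : nat -> A) (n : nat) : n.-tuple A :=
  [tuple z i | i < n].

Definition prefix {A : Type} {n k : nat} (le_kn : (k <= n)%N)
    (a : n.-tuple A) : k.-tuple A :=
  [tuple tnth a (widen_ord le_kn i) | i < k].

Section Information.
Context {R : realType}.

Definition log2 (x : R) : R := ln x / ln 2.

Definition is_pmf {A : finType} (p : A -> R) : Prop :=
  (forall a, 0 <= p a) /\ \sum_a p a = 1.

(* I(U; V | S) for random variables U, V, S on a finite probability space with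
   mass function p, as the mean of the information density
   log2 (P(U,V,S) P(S) / (P(U,S) P(V,S))); points of zero mass contribute 0. *)
Definition cond_mutual_info {Z A B C : finType} (p : Z -> R)
    (U : Z -> A) (V : Z -> B) (S : Z -> C) : R :=
  \sum_z p z *
    log2 ((\sum_(y | [&& U y == U z, V y == V z & S y == S z]) p y)
            * (\sum_(y | S y == S z) p y)
          / ((\sum_(y | (U y == U z) && (S y == S z)) p y)
            * (\sum_(y | (V y == V z) && (S y == S z)) p y))).

End Information.

Record channel (R : realType) := Channel {
  ch_M : nat ;
  ch_M_gt0 : (0 < ch_M)%N ;
  ch_out : finType ;
  (* ch_prob t q q' b = P(q'_t = b | q_{[0,t]} = q, q'_{[0,t-1]} = q') *)
  ch_prob : forall t : nat,
    t.+1.-tuple 'I_ch_M -> t.-tuple ch_out -> ch_out -> R ;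
  ch_pmf : forall t q q', is_pmf (@ch_prob t q q')
}.
Arguments ch_prob {R} c t _ _ _.

Section Capacity.
Context {R : realType} (ch : channel R).
Local Notation M := 'I_(ch_M ch).
Local Notation M' := (ch_out ch).

(* p t q q' a = P(q_t = a | q_{[0,t-1]} = q, q'_{[0,t-1]} = q') *)
Definition input_law : Type :=
  forall t : nat, t.-tuple M -> t.-tuple M' -> M -> R.

Definition is_input_law (p : input_law) : Prop :=
  forall t q q', is_pmf (p t q q').

(* The law of (q_{[0,T-1]}, q'_{[0,T-1]}). *)
Definition joint_law (p : input_law) (T : nat)
    (z : T.-tuple M * T.-tuple M') : R :=
  \prod_(t < T)
    (p t (prefix (ltnW (ltn_ord t)) z.1) (prefix (ltnW (ltn_ord t)) z.2)
         (tnth z.1 t)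
     * ch_prob ch t (prefix (ltn_ord t) z.1) (prefix (ltnW (ltn_ord t)) z.2)
         (tnth z.2 t)).

(* For t = 0 the conditioning variable is the empty tuple, so that this term is
   I(q_0; q'_0). *)
Definition directed_info (p : input_law) (T : nat) : R :=
  \sum_(t < T)
    cond_mutual_info (@joint_law p T)
      (fun z => prefix (ltn_ord t) z.1)
      (fun z => tnth z.2 t)
      (fun z => prefix (ltnW (ltn_ord t)) z.2).

(* The supremum is a maximum: directed_info is continuous in the finitely many
   conditional mass functions p 0, ..., p T.-1 it depends on. *)
Definition max_directed_info (T : nat) : R :=
  sup [set directed_info p T | p in is_input_law].

(* The limit is part of what is required of the channel: its capacity with
   feedback is by definition this limit. *)
Definition has_feedback_capacity (C : R) : Prop :=
  (fun T : nat => T%:R^-1 * max_directed_info T) @ \oo --> C.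

End Capacity.

Fixpoint trajectory {S W : Type} (f : S -> W -> S) (x0 : S) (w : nat -> W)
    (t : nat) : S :=
  if t is s.+1 then f (trajectory f x0 w s) (w s) else x0.

(* P(x_{t+1} \in B | x_t = x), for i.i.d. noise with law nu. *)
Definition transition_prob {R : realType} {N : nat} {X : set 'rV[R]_N}
    {dW} {W : measurableType dW} (f : X -> W -> X) (nu : probability W R)
    (x : X) (B : set 'rV[R]_N) : \bar R :=
  nu [set w | B (set_val (f x w))].

Section Estimation.
Context {R : realType} {N : nat} {X : set 'rV[R]_N} {xpt : X}.
Context {dW : measure_display} {W : measurableType dW}.
Local Notation S := (borelSpace xpt).
Variables (f : S -> W -> S) (pi0 : probability S R) (nu : probability W R).

Section Scheme.
Variable ch : channel R.
Local Notation M := 'I_(ch_M ch).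
Local Notation M' := (ch_out ch).

Definition coding_policy : Type :=
  forall t : nat, t.+1.-tuple S -> t.-tuple M' -> M.

(* As M and M' are finite, it suffices to look at the sections of enc t. *)
Definition measurable_coding_policy (enc : coding_policy) : Prop :=
  forall t (q' : t.-tuple M') (a : M),
    measurable [set x : t.+1.-tuple S | enc t x q' = a].

Definition estimation_policy : Type := forall t : nat, t.+1.-tuple M' -> S.

Section Processes.
Context {d : measure_display} {Omega : measurableType d}.
Variable P : probability Omega R.
Variables (x0 : Omega -> S) (w : nat -> Omega -> W) (q' : nat -> Omega -> M').
Variables (enc : coding_policy) (dec : estimation_policy).

Definition state (t : nat) (omega : Omega) : S :=
  trajectory f (x0 omega) (w ^~ omega) t.

Definition input (t : nat) (omega : Omega) : M :=
  enc (hist (state ^~ omega) t.+1) (hist (q' ^~ omega) t).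

Definition estimate (t : nat) (omega : Omega) : S :=
  dec (hist (q' ^~ omega) t.+1).

(* x0 has law pi0, the w_t are i.i.d. with law nu, and (w_t) is independent
   of x0. *)
Definition is_driven : Prop :=
  [/\ measurable_fun setT x0,
      forall t, measurable_fun setT (w t),
      forall A : set S, measurable A -> P (x0 @^-1` A) = pi0 A,
      forall t (B : set W), measurable B -> P (w t @^-1` B) = nu B &
      forall (n : nat) (A : set S) (B : nat -> set W),
        measurable A -> (forall i, measurable (B i)) ->
        P (x0 @^-1` A `&` \bigcap_(i < n) (w i @^-1` B i)) =
        (P (x0 @^-1` A) * \prod_(i < n) P (w i @^-1` B i))%E].

Definition channel_events (t : nat) : set (set Omega) :=
  [set E | (exists s a, (s <= t)%N /\ E = [set omega | input s omega = a]) \/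
           (exists s b, (s < t)%N /\ E = [set omega | q' s omega = b])].

Definition source_events : set (set Omega) :=
  [set E | (exists2 A : set S, measurable A & E = x0 @^-1` A) \/
           (exists s, exists2 B : set W, measurable B & E = w s @^-1` B)].

Definition is_channel_output : Prop :=
  (forall t b, measurable [set omega | q' t omega = b]) /\
  (forall t (B : {pred M'}),
     is_cond_prob P <<s channel_events t >> [set omega | q' t omega \in B]
       (fun omega => \sum_(b in B)
          ch_prob ch t (hist (input ^~ omega) t.+1) (hist (q' ^~ omega) t) b)).

(* P(q'_t \in B | q_{[0,t]}, q'_{[0,t-1]}, x_0, w_s, s >= 0)
     = P(q'_t \in B | q_{[0,t]}, q'_{[0,t-1]})  a.s. *)
Definition classA_markov : Prop :=
  forall t (B : {pred M'}) (phi : Omega -> R),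
    is_cond_prob P <<s channel_events t >> [set omega | q' t omega \in B] phi ->
    is_cond_prob P <<s channel_events t `|` source_events >>
      [set omega | q' t omega \in B] phi.

Definition objective_E2 (eps : R) : Prop :=
  P [set omega |
      (limn_esup (fun t => (enorm (set_val (state t omega)
                                   - set_val (estimate t omega)))%:E)
       <= eps%:E)%E] = 1%E.

End Processes.

(* The joint law of (x_0, (w_t), (q'_t)) is determined by pi0, nu, the channel,
   the coding policy and [classA_markov], so that the choice of the probability
   space on which these processes are realised is immaterial. *)
Definition achieves_E2 (enc : coding_policy) (dec : estimation_policy)
    (eps : R) : Prop :=
  exists (d : measure_display) (Omega : measurableType d)
    (P : probability Omega R) (x0 : Omega -> S) (w : nat -> Omega -> W)
    (q' : nat -> Omega -> M'),
    [/\ is_driven P x0 w,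
        is_channel_output P x0 w q' enc,
        classA_markov P x0 w q' enc &
        objective_E2 P x0 w q' dec eps].

End Scheme.

Definition C0 : \bar R :=
  ereal_inf [set C%:E | C in [set C : R |
    exists ch : channel R,
      has_feedback_capacity ch C /\
      forall eps : R, 0 < eps ->
        exists (enc : coding_policy ch) (dec : estimation_policy ch),
          measurable_coding_policy enc /\ achieves_E2 enc dec eps]].

End Estimation.

(* Main.v *)
Require Import Defs.
From HB Require Import structures.
From mathcomp Require Import all_boot all_order all_algebra.
From mathcomp Require Import all_classical all_reals all_analysis.
From mathcomp Require Import measurable_realfun lra.

Set Implicit Arguments.
Unset Strict Implicit.
Unset Printing Implicit Defensive.
Import Order.TTheory GRing.Theory Num.Theory.
Import numFieldNormedType.Exports.

Local Open Scope classical_set_scope.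
Local Open Scope ring_scope.

(** The obstruction is a count of decoder outputs. Let m be the size of the
    output alphabet and fix a radius r. Up to time s + n the decoder sees one of
    m ^ (s + n + 1) output words, and each word prescribes a sequence of balls of
    radius r in which the state would have to lie at the times s + 1, ..., s + n.
    Given the past, the next state falls in a prescribed ball with probability at
    most kappa = K (2 r) ^ N, whatever the current state is, so that a prescribed
    sequence of n balls is followed with probability at most kappa ^ n
    ([trajectory_confined_le]). The union bound over the words
    ([tracked_from_le]) shows that the error stays below r from time s on with
    probability at most m ^ (s + 1) (m kappa) ^ n for every n. If r is so small
    that m kappa <= 1/2, this probability is zero for every s, and hence the
    upper limit of the error is almost surely at least r ([not_objective_E2]).
    The radius depends only on m, K and N: for every channel some epsilon is out
    of reach, and [C0] is the infimum of the empty set.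

    The bound kappa ^ n needs the Markov property of the state process, while
    [is_driven] only gives a product formula on rectangles. It is propagated in
    time as the relation [independent_of_future], by the uniqueness of product
    measures ([independent_pair_law], [independent_of_future_pair]). *)

(** * Independence of the state from the future noise *)

Lemma measurable_preimage d1 d2 (T1 : measurableType d1)
    (T2 : measurableType d2) (g : T1 -> T2) (A : set T2) :
  measurable_fun setT g -> measurable A -> measurable (g @^-1` A).
Proof. by move=> mg mA; rewrite -[X in measurable X]setTI; exact: mg. Qed.

Section RestrictedLaw.
Context {R : realType} {d : measure_display} {Omega : measurableType d}.
Context {dS : measure_display} {S : measurableType dS}.
Variables (P : probability Omega R) (E : set Omega) (mE : measurable E).
Variables (x : Omega -> S) (mx : measurable_fun setT x).

(** The measurability proof of [x] is an argument so that the measure structure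
    can be inferred from the term. *)
Definition restricted_law (_ : measurable_fun setT x) : set S -> \bar R :=
  pushforward (mrestr P mE) x.

Local Notation law := (restricted_law mx).

Let law0 : law set0 = 0%E. Proof. exact: measure0. Qed.

Let law_ge0 A : (0 <= law A)%E. Proof. exact: measure_ge0. Qed.

Let law_sigma_additive : semi_sigma_additive law.
Proof. exact: measure_semi_sigma_additive. Qed.

HB.instance Definition _ :=
  isMeasure.Build _ _ _ law law0 law_ge0 law_sigma_additive.

Let law_fin : fin_num_fun law.
Proof.
move=> A mA; rewrite /restricted_law /pushforward /mrestr.
rewrite fin_num_measure//; apply: measurableI => //.
exact: measurable_preimage.
Qed.

HB.instance Definition _ := Measure_isFinite.Build _ _ _ law law_fin.

End RestrictedLaw.

Section Independence.
Context {R : realType} {d : measure_display} {Omega : measurableType d}.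
Context {dS : measure_display} {S : measurableType dS}.
Context {dW : measure_display} {W : measurableType dW}.
Variables (P : probability Omega R) (nu : probability W R).

(** Both sides are finite measures of [C], the right-hand one being the product
    of the restricted law of [x] with [nu], and they agree on rectangles. *)
Lemma independent_pair_law (E : set Omega) (mE : measurable E)
    (x : Omega -> S) (mx : measurable_fun setT x)
    (v : Omega -> W) (mv : measurable_fun setT v) :
  (forall A B, measurable A -> measurable B ->
     P (E `&` (x @^-1` A `&` v @^-1` B)) = (P (E `&` x @^-1` A) * nu B)%E) ->
  forall C : set (S * W), measurable C ->
    P (E `&` [set omega | C (x omega, v omega)]) =
    (\int[restricted_law P mE mx]_y nu (xsection C y))%E.
Proof.
move=> indep C mC.
have mxv : measurable_fun setT (fun omega => (x omega, v omega)).
  exact: measurable_fun_pair.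
have := @product_measure_unique _ _ _ _ _ (restricted_law P mE mx) nu
  (restricted_law P mE mxv).
move=> /(_ _ C mC); rewrite /product_measure1/= => -> => [|A B mA mB].
  by rewrite /restricted_law /pushforward /mrestr setIC.
rewrite /restricted_law /pushforward /mrestr.
rewrite [_ `&` E]setIC [in RHS]setIC -indep//.
Qed.

Variables (w : nat -> Omega -> W) (mw : forall t, measurable_fun setT (w t)).

Definition future (t n : nat) (B : nat -> set W) : set Omega :=
  \bigcap_(i < n) (w (t + i)%N @^-1` B i).

(** Conditionally on [E], the value of [x] is independent of the noise from time
    [t] on, and this noise is i.i.d. with law [nu]. In the sequel [x] is the state
    at time [t] and [E] an event of the past. *)
Definition independent_of_future (t : nat) (E : set Omega) (x : Omega -> S) :=
  forall (n : nat) (A : set S) (B : nat -> set W),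
    measurable A -> (forall i, measurable (B i)) ->
    P (E `&` x @^-1` A `&` future t n B) =
    (P (E `&` x @^-1` A) * \prod_(i < n) nu (B i))%E.

Lemma measurable_future t n B :
  (forall i, measurable (B i)) -> measurable (future t n B).
Proof.
move=> mB; rewrite /future bigcap_mkord; apply: bigsetI_measurable => i _.
exact: measurable_preimage.
Qed.

Lemma futureS t n B : future t n.+1 B =
  w t @^-1` B 0%N `&` future t.+1 n (fun i => B i.+1).
Proof.
apply/seteqP; split => omega; rewrite /future.
  move=> h; split; first by have := h 0%N isT; rewrite /= addn0.
  by move=> i /= lt_in; rewrite addSnnS; exact: (h i.+1).
move=> [h0 h] [|i] /= lt_in; first by rewrite addn0.
by rewrite -addSnnS; exact: h.
Qed.

Lemma future0 t B : future t 0 B = setT.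
Proof. by rewrite /future bigcap_mkord big_ord0. Qed.

Lemma independent_of_future_setI t E x A : measurable A ->
  independent_of_future t E x -> independent_of_future t (E `&` x @^-1` A) x.
Proof.
move=> mA indep n A' B mA' mB; rewrite -!setIA !(setIA (x @^-1` A)).
by rewrite -preimage_setI setIA; apply: indep => //; exact: measurableI.
Qed.

(** The pair of [x] and the current noise is independent of the later noise:
    [independent_pair_law] is applied on the intersection of [E] with the event
    of the later noise, where the law of [x] is by hypothesis the law of [x] on
    [E], multiplied by the constant [\prod_(i < n) nu (B i)]. *)
Lemma independent_of_future_pair t E (mE : measurable E) x
    (mx : measurable_fun setT x) : independent_of_future t E x ->
  forall (C : set (S * W)) n B, measurable C -> (forall i, measurable (B i)) ->
    P (E `&` [set omega | C (x omega, w t omega)] `&` future t.+1 n B) =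
    (\prod_(i < n) nu (B i) *
     \int[restricted_law P mE mx]_y nu (xsection C y))%E.
Proof.
move=> indep C n B mC mB.
have mF : measurable (future t.+1 n B) by exact: measurable_future.
have mEF : measurable (E `&` future t.+1 n B) by exact: measurableI.
(* The events of the noise from time t on: B0 at time t, then B. *)
pose cons (B0 : set W) i := if i is j.+1 then B j else B0.
have mcons B0 : measurable B0 -> forall i, measurable (cons B0 i).
  by move=> mB0 [|i]; [exact: mB0|exact: mB].
have consE B0 : future t n.+1 (cons B0) = w t @^-1` B0 `&` future t.+1 n B.
  exact: futureS.
have lawEF A : measurable A -> P (E `&` future t.+1 n B `&` x @^-1` A) =
    (P (E `&` x @^-1` A) * \prod_(i < n) nu (B i))%E.
  move=> mA; rewrite setIAC.
  have := indep n.+1 A (cons setT) mA (mcons _ measurableT).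
  rewrite consE preimage_setT setTI big_ord_recl /= probability_setT mul1e.
  by move=> ->.
rewrite setIAC (independent_pair_law mEF mx (mw t)) //; last first.
  move=> A B0 mA mB0; rewrite lawEF//.
  have := indep n.+1 A (cons B0) mA (mcons _ mB0).
  rewrite consE big_ord_recl /= [(nu B0 * _)%E]muleC muleA => <-; congr (P _).
  by rewrite -!setIA; congr (_ `&` _); rewrite setICA; congr (_ `&` _);
    rewrite setIC.
have prod_fin : (\prod_(i < n) nu (B i))%E \is a fin_num.
  by apply: prode_fin_num => i _; exact: fin_num_measure.
have prod_ge0 : 0 <= fine (\prod_(i < n) nu (B i))%E.
  by apply: fine_ge0; apply: prode_ge0.
rewrite (@eq_measure_integral _ _ _ _
  (mscale (NngNum prod_ge0) (restricted_law P mE mx))); last first.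
  move=> A mA _; rewrite /mscale/= /restricted_law /pushforward /mrestr.
  by rewrite setIC lawEF// muleC setIC /mscale/= fineK.
rewrite ge0_integral_mscale//=; last exact: measurable_fun_xsection.
by rewrite fineK.
Qed.


Variables (f : S -> W -> S).
Hypothesis mf : measurable_fun setT (fun p : S * W => f p.1 p.2).

Lemma independent_of_future_step t E (mE : measurable E) x
    (mx : measurable_fun setT x) : independent_of_future t E x ->
  independent_of_future t.+1 E (fun omega => f (x omega) (w t omega)).
Proof.
move=> indep n A B mA mB.
have mC := measurable_preimage mf mA.
have := independent_of_future_pair mE mx indep.
move=> pairE; rewrite [LHS](pairE _ n B mC mB) muleC; congr (_ * _)%E.
have := pairE _ 0%N B mC mB.
by rewrite future0 setIT big_ord0 mul1e => <-.
Qed.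

(** The mass that the product law gives to the event is the mean over [x] of
    one-step probabilities, each of which is at most [kappa]. *)
Lemma independent_of_future_hit_le t E (mE : measurable E) x
    (mx : measurable_fun setT x) (D : set S) (kappa : \bar R) :
  independent_of_future t E x -> measurable D ->
  (forall y, nu [set v | D (f y v)] <= kappa)%E ->
  (P (E `&` [set omega | D (f (x omega) (w t omega))]) <= kappa * P E)%E.
Proof.
move=> indep mD nuD.
have mC := measurable_preimage mf mD.
have := independent_of_future_pair mE mx indep.
move=> /(_ _ 0%N (fun=> setT) mC (fun=> measurableT)).
rewrite future0 setIT big_ord0 mul1e => /= ->.
have -> : (kappa * P E = \int[restricted_law P mE mx]_y cst kappa y)%E.
  rewrite integral_cst// /restricted_law /pushforward /mrestr.
  by congr (_ * P _)%E; exact/esym/setTI.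
apply: ge0_le_integral => //.
  exact: measurable_fun_xsection.
move=> y _; rewrite /xsection; apply: le_trans (nuD y).
rewrite le_eqVlt; apply/orP; left; apply/eqP; congr (nu _).
by apply/seteqP; split=> v /=; rewrite inE.
Qed.

Variables (x0 : Omega -> S) (mx0 : measurable_fun setT x0).
Hypothesis indep0 : independent_of_future 0 setT x0.

Local Notation x_ t := (fun omega => trajectory f (x0 omega) (w ^~ omega) t).

Lemma measurable_trajectory t : measurable_fun setT (x_ t).
Proof.
elim: t => [|t IH] //=.
exact: (measurableT_comp mf (measurable_fun_pair IH (mw t))).
Qed.

Lemma trajectory_independent_of_future t : independent_of_future t setT (x_ t).
Proof.
elim: t => [|t IH] //=.
exact: (independent_of_future_step measurableT (measurable_trajectory t) IH).
Qed.

(** The induction also carries along that the state at time [s + n] remains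
    independent of the future noise on the event that the first [n] constraints
    hold, so that the next constraint contributes a factor [kappa]. *)
Lemma trajectory_confined_le (s n : nat) (D : nat -> set S) (kappa : R) :
  0 <= kappa -> (forall i, measurable (D i)) ->
  (forall i y, nu [set v | D i (f y v)] <= kappa%:E)%E ->
  (P (\bigcap_(i < n) [set omega | D i (x_ (s + i).+1 omega)]) <=
   (kappa ^+ n)%:E)%E.
Proof.
move=> kappa_ge0 mD nuD.
pose E n := \bigcap_(i < n) [set omega | D i (x_ (s + i).+1 omega)].
rewrite -/(E n).
have ES m : E m.+1 = E m `&` [set omega | D m (x_ (s + m).+1 omega)].
  by rewrite /E !bigcap_mkord big_ord_recr.
suff [] : [/\ measurable (E n),
  independent_of_future (s + n) (E n) (x_ (s + n)%N) &
  P (E n) <= (kappa ^+ n)%:E]%E by [].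
elim: n => [|n [mEn indep PEn]].
  have -> : E 0%N = setT by rewrite /E bigcap_mkord big_ord0.
  rewrite addn0 expr0 probability_setT; split => //.
  exact: trajectory_independent_of_future.
rewrite ES; split.
- apply: measurableI => //.
  exact: (measurable_preimage (measurable_trajectory (s + n).+1)).
- rewrite addnS; apply: (independent_of_future_setI (mD n)).
  exact: (independent_of_future_step mEn (measurable_trajectory (s + n))).
- apply: le_trans 
    (independent_of_future_hit_le mEn (measurable_trajectory (s + n)) indep
       (mD n) (nuD n)) _.
  by rewrite exprS EFinM lee_wpmul2l// lee_fin.
Qed.

End Independence.

(** * Balls in Euclidean space *)

Section Euclidean.
Context {R : realType} {N : nat}.
Implicit Types (c v : 'rV[R]_N) (r : R).

Lemma coord_le_enorm v i : `|v ord0 i| <= enorm v.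
Proof.
rewrite /enorm -sqrtr_sqr ler_sqrt ?sumr_ge0// => [|j _]; last exact: sqr_ge0.
by rewrite (bigD1 i)//= lerDl sumr_ge0// => j _; exact: sqr_ge0.
Qed.

Lemma continuous_enorm_sub c : continuous (fun v => enorm (v - c)).
Proof.
move=> v; apply: (@continuous_comp _ _ _
    (fun u : 'rV[R]_N => \sum_(i < N) (u - c) ord0 i ^+ 2) Num.sqrt);
  last exact: sqrt_continuous.
apply: (@continuous_big _ _ +%R) => [|i _].
  exact: add_continuous.
move=> {}v; apply: (@continuous_comp _ _ _ (fun v => (v - c) ord0 i)
    (fun a => a ^+ 2)).
  have -> : (fun v => (v - c) ord0 i) = (fun v => v ord0 i - c ord0 i).
    by apply/funext => u; rewrite !mxE.
  apply: continuousB; last exact: cst_continuous.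
  exact: (@coord_continuous _ _ _ ord0 i).
exact: exprn_continuous.
Qed.

Definition eball c r : set 'rV[R]_N := [set v | enorm (v - c) < r].

Lemma open_eball c r : open (eball c r).
Proof.
have /continuousP := @continuous_enorm_sub c.
by move=> /(_ _ (@open_lt R r)).
Qed.

(** The ball lies in a cube of side [2 * r]. The cover is completed by empty
    boxes, whose volume is zero because [N] is positive. *)
Lemma lebesgue_rV_eball_le c r : (0 < N)%N -> 0 <= r ->
  (lebesgue_rV (eball c r) <= ((2 * r) ^+ N)%:E)%E.
Proof.
move=> N_gt0 r_ge0; apply: ereal_inf_lbound.
pose lower (k : nat) : 'rV[R]_N := if k is 0%N then c - const_mx r else 0.
pose upper (k : nat) : 'rV[R]_N := if k is 0%N then c + const_mx r else 0.
exists (lower, upper).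
  split=> [k i|v vB] /=.
    by case: k => [|k]//; rewrite !mxE; lra.
  exists 0%N => //= i; have := le_lt_trans (coord_le_enorm (v - c) i) vB.
  rewrite !mxE ltr_norml => /andP[? ?]; apply/andP; split; lra.
rewrite /= nneseries_recl//=; last first.
  move=> k _; rewrite lee_fin; apply: prodr_ge0 => i _.
  by case: k => [|k]; rewrite !mxE; lra.
rewrite eseries0 ?adde0; last first.
  move=> [|k]//= _ _; rewrite (bigD1 (Ordinal N_gt0))//= subrr mul0r//.
congr EFin; rewrite (eq_bigr (fun=> 2 * r)); last first.
  by move=> i _; rewrite !mxE; lra.
by rewrite prodr_const card_ord.
Qed.

Context {X : set 'rV[R]_N} {xpt : X}.

Lemma continuous_borel_measurable (g : 'rV[R]_N -> R) : continuous g ->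
  measurable_fun setT (fun x : borelSpace xpt => g (set_val x)).
Proof.
move=> gc; apply: (measurability _ (RGenOpens.measurableE R)).
move=> _ [_ [a [b ->] <-]]; rewrite setTI; apply: sub_sigma_algebra => /=.
rewrite (_ : _ @^-1` _ = set_val @^-1` (g @^-1` `]a, b[))//.
have /continuousP := @initial_continuous X _ set_val.
apply; move/continuousP: gc; apply; exact: interval_open.
Qed.

End Euclidean.

Lemma limn_esup_lt_near (R : realType) (u : (\bar R)^nat) (r : \bar R) :
  (limn_esup u < r)%E -> \forall t \near \oo, (u t < r)%E.
Proof.
move=> /ereal_inf_lt[_ [V Voo <-]] supV; near=> t.
apply: le_lt_trans supV; apply: ereal_sup_ubound; exists t => //.
by near: t.
Unshelve. all: by end_near. Qed.

(** * Random indices in a finite set, and limits *)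

Section FiniteIndex.
Context {R : realType} {d : measure_display} {Omega : measurableType d}.
Variables (P : probability Omega R) (T : finType).

Lemma bigsetU_finType (F : T -> set Omega) :
  \big[setU/set0]_s F s = \bigcup_s F s.
Proof.
rewrite -bigcup_seq; apply/seteqP; split=> omega [s _ Fs]; exists s => //.
exact: mem_index_enum.
Qed.

Lemma measure_bigcup_finType_le (F : T -> set Omega) :
  (forall s, measurable (F s)) -> (P (\bigcup_s F s) <= \sum_s P (F s))%E.
Proof.
move=> mF; rewrite -bigsetU_finType.
elim: (index_enum T) => [|s r IH]; first by rewrite !big_nil measure0.
rewrite !big_cons; apply: le_trans (leeD2l _ IH).
by apply: measureU2 => //; exact: bigsetU_measurable.
Qed.

Lemma measurable_fun_finite_index d' (Y : measurableType d')
    (h : Omega -> T) (F : T -> Omega -> Y) :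
  (forall s, measurable (h @^-1` [set s])) ->
  (forall s, measurable_fun setT (F s)) ->
  measurable_fun setT (fun omega => F (h omega) omega).
Proof.
move=> mh mF _ A mA; rewrite setTI.
rewrite (_ : _ @^-1` A = \bigcup_s (h @^-1` [set s] `&` F s @^-1` A)).
  rewrite -bigsetU_finType; apply: bigsetU_measurable => s _.
  by apply: measurableI => //; exact: measurable_preimage.
apply/seteqP; split=> [omega AF|omega [s _ [<-]]//].
by exists (h omega).
Qed.

End FiniteIndex.

Lemma measurable_hist_level d (Omega : measurableType d) (T : finType)
    (q : nat -> Omega -> T) n (s : n.-tuple T) :
  (forall t b, measurable [set omega | q t omega = b]) ->
  measurable ((fun omega => hist (q ^~ omega) n) @^-1` [set s]).
Proof.
move=> mq; rewrite (_ : _ @^-1` _ =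
    \big[setI/setT]_(i < n) [set omega | q i omega = tnth s i]).
  by apply: bigsetI_measurable => i _; exact: mq.
rewrite -bigcap_seq; apply/seteqP; split=> omega /=.
  by move=> <- i _; rewrite /= tnth_mktuple.
move=> qs; apply: eq_from_tnth => i; rewrite tnth_mktuple.
by apply: qs; exact: mem_index_enum.
Qed.

(** An output word of finite length, extended by [b] to a sequence, has the same
    histories as the original sequence up to the length of the word. *)
Lemma hist_nth (T : Type) (b : T) (q : nat -> T) (m n : nat) : (n <= m)%N ->
  hist (nth b (hist q m)) n = hist q n.
Proof.
move=> le_nm; apply: eq_from_tnth => i; rewrite !tnth_mktuple.
have lt_im : (i < m)%N := leq_trans (ltn_ord i) le_nm.
by rewrite -[nat_of_ord i]/(nat_of_ord (Ordinal lt_im)) -tnth_nth tnth_mktuple.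
Qed.

Lemma le0_of_le_geometric (R : realType) (p a : R) :
  (forall n, p <= a * 2^-1 ^+ n) -> p <= 0.
Proof.
move=> pa; have half : `|2^-1 : R| < 1 by rewrite ger0_norm; lra.
have cvg0 := cvg_geometric a half.
rewrite -(cvg_lim (@Rhausdorff R) cvg0); apply: limr_ge.
  by apply/cvg_ex; exists 0.
by near=> n; exact: pa.
Unshelve. all: by end_near. Qed.

(** * Tracking over a finite output alphabet *)

Section Tracking.
Context {R : realType} {N : nat} {X : set 'rV[R]_N} {xpt : X}.
Context {dW : measure_display} {W : measurableType dW}.
Local Notation S := (borelSpace xpt).
Variables (f : S -> W -> S) (pi0 : probability S R) (nu : probability W R).
Variable ch : channel R.
Context {d : measure_display} {Omega : measurableType d}.
Variables (P : probability Omega R) (x0 : Omega -> S) (w : nat -> Omega -> W).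
Variables (q' : nat -> Omega -> ch_out ch).
Variable (dec : estimation_policy (xpt := xpt) ch).
Hypothesis mf : measurable_fun setT (fun p : S * W => f p.1 p.2).
Hypothesis driven : is_driven pi0 nu P x0 w.
Hypothesis mq' : forall t b, measurable [set omega | q' t omega = b].

Local Notation state := (state f x0 w).
Local Notation estimate := (estimate q' dec).

Lemma driven_measurable_state t : measurable_fun setT (state t).
Proof.
have [mx0 mw _ _ _] := driven.
exact: measurable_trajectory.
Qed.

Lemma driven_independent : independent_of_future P nu w 0 setT x0.
Proof.
have [_ _ _ law_w indep] := driven; move=> n A B mA mB.
rewrite setTI [LHS](indep n A B mA mB); congr (_ * _)%E.
by apply: eq_bigr => i _; rewrite law_w.
Qed.

(** The estimate takes one value per output word, so the error is pieced together
    from finitely many functions of the state. *)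
Lemma measurable_error t : measurable_fun setT
  (fun omega => enorm (set_val (state t omega) - set_val (estimate t omega))).
Proof.
apply: (@measurable_fun_finite_index _ _ _ _ _
  (fun omega => hist (q' ^~ omega) t.+1)
  (fun s omega => enorm (set_val (state t omega) - set_val (dec s)))).
  by move=> s; exact: measurable_hist_level.
move=> s; have mg := continuous_borel_measurable (xpt := xpt)
  (@continuous_enorm_sub R N (set_val (dec s))).
exact: (measurableT_comp mg (driven_measurable_state t)).
Qed.

Variables (kappa r : R).
Hypothesis kappa_ge0 : 0 <= kappa.
Hypothesis ball_le : forall (x : S) (c : 'rV[R]_N),
  (transition_prob f nu x (eball c r) <= kappa%:E)%E.

Definition tracked_from (s : nat) : set Omega :=
  \bigcap_(t in [set t | (s <= t)%N])
    [set omega |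
      enorm (set_val (state t omega) - set_val (estimate t omega)) < r].

Lemma measurable_tracked_from s : measurable (tracked_from s).
Proof.
apply: bigcap_measurable; first by exists s => /=.
move=> t _; rewrite (_ : [set _ | _] = (fun omega =>
  enorm (set_val (state t omega) - set_val (estimate t omega))) @^-1` `]-oo, r[).
  by apply: measurable_preimage => //; exact: measurable_error.
by apply/seteqP; split=> omega /=; rewrite in_itv.
Qed.

Lemma measurable_borel_eball c :
  measurable [set x : S | eball c r (set_val x)].
Proof.
rewrite (_ : [set _ | _] =
  (fun x : S => enorm (set_val x - c)) @^-1` `]-oo, r[).
  apply: measurable_preimage => //.
  exact: (continuous_borel_measurable (@continuous_enorm_sub R N c)).
by apply/seteqP; split=> x /=; rewrite in_itv.
Qed.

(** Union bound over the output words up to time [s + n]; the constraints used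
    are those at the times [s + 1], ..., [s + n]. *)
Lemma tracked_from_le s n : (P (tracked_from s) <=
  (#|ch_out ch|%:R ^+ (s + n).+1 * kappa ^+ n)%:E)%E.
Proof.
have [mx0 mw _ _ _] := driven.
pose b0 := q' 0 point.
(* The ball around the estimate that the decoder produces on the word u. *)
pose D (u : (s + n).+1.-tuple (ch_out ch)) i : set S :=
  [set x | eball (set_val (dec (hist (nth b0 u) (s + i).+2))) r (set_val x)].
have mD u i : measurable (D u i) by exact: measurable_borel_eball.
pose H u := \bigcap_(i < n) [set omega | D u i (state (s + i).+1 omega)].
have mH u : measurable (H u).
  rewrite /H bigcap_mkord; apply: bigsetI_measurable => i _.
  by apply: (measurable_preimage (driven_measurable_state _)).
have tracked_H : tracked_from s `<=` \bigcup_u H u.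
  move=> omega tr; exists (hist (q' ^~ omega) (s + n).+1) => // i /= lt_in.
  suff : D (hist (q' ^~ omega) (s + n).+1) i (state (s + i).+1 omega) by [].
  rewrite /D hist_nth; last by rewrite !ltnS -addnS leq_add2l.
  by apply: (tr (s + i).+1) => /=; rewrite ltnW// ltnS leq_addr.
apply: le_trans (le_measure _ _ _ tracked_H) _.
- by rewrite inE; exact: measurable_tracked_from.
- rewrite inE -bigsetU_finType; exact: bigsetU_measurable.
apply: le_trans (measure_bigcup_finType_le _ mH) _.
apply: (@le_trans _ _
  (\sum_(u : (s + n).+1.-tuple (ch_out ch)) (kappa ^+ n)%:E)%E).
  apply: lee_sum => u _.
  apply: (trajectory_confined_le mw mf mx0 driven_independent s n
    kappa_ge0 (mD u)).
  by move=> i y; exact: ball_le.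
by rewrite sumEFin lee_fin sumr_const card_tuple -[leLHS]mulr_natl natrX.
Qed.

Lemma tracked_from_null s :
  #|ch_out ch|%:R * kappa <= 2^-1 -> P (tracked_from s) = 0%E.
Proof.
move=> small; apply/eqP; rewrite eq_le measure_ge0 andbT.
have fin : P (tracked_from s) \is a fin_num.
  by apply: fin_num_measure; exact: measurable_tracked_from.
rewrite -(fineK fin) lee_fin.
apply: (@le0_of_le_geometric _ _ (#|ch_out ch|%:R ^+ s.+1)) => n.
rewrite -lee_fin fineK//; apply: le_trans (tracked_from_le s n) _.
rewrite lee_fin -addSn exprD -mulrA -exprMn ler_wpM2l ?exprn_ge0//.
by rewrite lerXn2r// nnegrE ?mulr_ge0//; lra.
Qed.

(** An upper limit below [r] means that the error stays below [r] from some time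
    on, which is a countable union of null events. The event of the objective has
    to be shown measurable, since [P] is arbitrary on the other sets. *)
Lemma not_objective_E2 eps : #|ch_out ch|%:R * kappa <= 2^-1 -> eps < r ->
  ~ objective_E2 f P x0 w q' dec eps.
Proof.
move=> small lt_eps_r; rewrite /objective_E2.
set L := [set _ | _]; suff -> : P L = 0%E by move=> /esym/eqP; rewrite onee_eq0.
apply: measure_negligible.
  rewrite (_ : L = (fun omega => limn_esup (fun t =>
      (enorm (set_val (state t omega) - set_val (estimate t omega)))%:E))
      @^-1` [set` `]-oo, eps%:E]%E]).
    apply: measurable_preimage; last exact: emeasurable_itv.
    apply: measurable_fun_limn_esup => t.
    exact/measurable_EFinP/measurable_error.
  by apply/seteqP; split=> omega /=; rewrite in_itv.
apply: (@negligibleS _ _ _ _ (\bigcup_s tracked_from s)).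
  move=> omega /= le_eps.
  have eps_r : (eps%:E < r%:E)%E by rewrite lte_fin.
  have [s _ near_s] := limn_esup_lt_near (le_lt_trans le_eps eps_r).
  by exists s => // t /= le_st; have := near_s t le_st; rewrite /= lte_fin.
apply: negligible_bigcup => s; apply/negligibleP.
  exact: measurable_tracked_from.
exact: tracked_from_null.
Qed.

End Tracking.

(** * Infinite capacity threshold *)

Theorem mainTheorem5 (R : realType) (N : nat) (N_gt0 : (0 < N)%N)
  (X : set 'rV[R]_N) (xpt : X)
  (dW : measure_display) (W : measurableType dW)
  (f : borelSpace xpt -> W -> borelSpace xpt)
  (f_measurable :
    measurable_fun setT (fun p : borelSpace xpt * W => f p.1 p.2))
  (f_homeo : forall w : W, homeomorphism (f ^~ w))
  (pi0 : probability (borelSpace xpt) R) (nu : probability W R)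
  (K : R) (K_ge0 : 0 <= K)
  (transition_le : forall (x : X) (B : set 'rV[R]_N), borel_set B ->
    (transition_prob f nu x B <= K%:E * lebesgue_rV B)%E) :
  C0 f pi0 nu = +oo%E.
Proof.
rewrite /C0 (_ : [set C%:E | C in _] = set0) ?ereal_inf0//.
apply/seteqP; split=> // _ [C [ch [_ achieved]] _] /=.
pose mK : R := #|ch_out ch|%:R * K.
have mK_ge0 : 0 <= mK by rewrite mulr_ge0.
(* With this radius mK * (2 * r) <= 1/2, and as 2 * r <= 1 the power
   (2 * r) ^+ N of the volume bound is at most 2 * r. *)
pose r : R := (4 * (mK + 1))^-1.
have r_gt0 : 0 < r by rewrite invr_gt0; lra.
have r_le : mK * (2 * r) <= 2^-1 /\ 2 * r <= 1.
  have rE : 2 * r = 2^-1 * (mK + 1)^-1.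
    by rewrite /r invfM mulrA; congr (_ * _); lra.
  have inv_le1 : (mK + 1)^-1 <= 1 by rewrite invf_le1; lra.
  have frac_le1 : mK * (mK + 1)^-1 <= 1 by rewrite ler_pdivrMr; lra.
  by rewrite rE mulrCA; split; lra.
have r2_gt0 : 0 < r / 2 by lra.
have [enc [dec [_ reached]]] := achieved _ r2_gt0.
have [d [T [P [x0 [w [q' [driven output _ E2]]]]]]] := reached.
apply: (not_objective_E2 f_measurable driven output.1
  (kappa := K * (2 * r) ^+ N) (r := r) _ _ _ _ E2).
- by rewrite mulr_ge0// exprn_ge0//; lra.
- move=> x c; apply: le_trans (transition_le x _ _) _.
    by apply: sub_sigma_algebra; exact: open_eball.
  rewrite EFinM lee_wpmul2l ?lee_fin//.
  by apply: lebesgue_rV_eball_le => //; exact: ltW.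
- rewrite mulrA; apply: le_trans r_le.1; rewrite ler_wpM2l//.
  rewrite -[leRHS]expr1 ler_wiXn2l//; lra.
- lra.
Qed.
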